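(* Let $\mathcal{R}_1,\mathcal{R}_2,\mathcal{S}$ be TRSs over $\mathcal{F}$, $L$ a set of terms each terminating with respect to $\to_{(\mathcal{R}_1\cup\mathcal{R}_2)/\mathcal{S}}$, and $\mathcal{M}$ a matrix interpretation with constant growth such that $\mathcal{R}_1\subseteq\ \succsim^{\mathrm{ncp}}_{\mathcal{M}}$, $\mathcal{R}_2\subseteq\ \succ_{\mathcal{M}}$ and $\mathcal{S}\subseteq\ \succsim_{\mathcal{M}}$. Then \[ \mathrm{cp}(n,\to_{(\mathcal{R}_1\cup\mathcal{R}_2)/\mathcal{S}},L)=O\bigl(\mathrm{cp}(n,\to_{\mathcal{R}_1/(\mathcal{R}_2\cup\mathcal{S})},L)+n\bigr). \]
   Context: $\to_{\mathcal{R}/\mathcal{S}}=\to_{\mathcal{S}}^*\cdot\to_{\mathcal{R}}\cdot\to_{\mathcal{S}}^*$; $\mathrm{dl}(t,\to)=\sup\{m\mid\exists u,\ t\to^mu\}$; $\mathrm{cp}(n,\to,L)=\sup\{\mathrm{dl}(t,\to)\mid t\in L,|t|\le n\}$. A matrix interpretation $\mathcal{M}$ of dimension $d\ge1$ interprets each $n$-ary $f\in\mathcal{F}$ as $f_{\mathcal{M}}(\vec x_1,\dots,\vec x_n)=F_1\vec x_1+\dots+F_n\vec x_n+\vec f$ with $F_i\in\mathbb{N}^{d\times d}$, $\vec f\in\mathbb{N}^d$ and $(F_i)_{(1,1)}\ge1$. On $\mathbb{N}^d$, $\vec u\succsim\vec v$ is pointwise $\ge$, and $\vec u\succ\vec v$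 iff $u_1>v_1$ and $\vec u\succsim\vec v$. $[\alpha]_{\mathcal{M}}(t)$ is the evaluation of $t$ under an assignment $\alpha$ of variables to $\mathbb{N}^d$; $s\succ_{\mathcal{M}}t$ (resp. $s\succsim_{\mathcal{M}}t$) iff $[\alpha]_{\mathcal{M}}(s)\succ[\alpha]_{\mathcal{M}}(t)$ (resp. $\succsim$) for all $\alpha$. $\mathcal{M}$ has constant growth if there is a matrix $A$ such that for all $p\in\mathbb{N}$ and all matrices $M_1,\dots,M_p$ occurring in $\mathcal{M}$ (as some $F_i$), $M_1\cdots M_p\le A$ pointwise. For terms $s,t$ with variables among $x_1,\dots,x_k$ one can write $[\alpha]_{\mathcal{M}}(s)=S_1\alpha(x_1)+\dots+S_k\alpha(x_k)+\vec s$ and $[\alpha]_{\mathcal{M}}(t)=T_1\alpha(x_1)+\dots+T_k\alpha(x_k)+\vec t$; the non-constant part is $[\alpha]^{\mathrm{ncp}}_{\mathcal{M}}(s)=S_1\alpha(x_1)+\dots+S_k\alpha(x_k)$, and $s\succsim^{\mathrm{ncp}}_{\mathcal{M}}t$ iff $[\alpha]^{\mathrm{ncp}}_{\mathcal{M}}(s)\succsim[\alpha]^{\mathrm{ncp}}_{\mathcal{M}}(t)$ for all $\alpha$. A TRS $\mathcal{T}\subseteq{\sqsupset}$ means $l\sqsupset r$ for every rule $l\to r\in\mathcal{T}$. *)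

(* Defs.v *)
From Stdlib Require Import Relation_Operators.
From mathcomp Require Import all_boot all_order all_algebra.
From mathcomp Require Import all_classical all_reals ereal.

Set Implicit Arguments.
Unset Strict Implicit.
Unset Printing Implicit Defensive.

Import Order.TTheory GRing.Theory Num.Theory.
Local Open Scope classical_set_scope.
Local Open Scope ring_scope.

Record signature := Signature { symbol :> Type; arity : symbol -> nat }.
Arguments arity {_} _.

Section Terms.
Variables (F : signature) (V : eqType).

Inductive term : Type :=
| Var (x : V)
| App (f : F) (ts : 'I_(arity f) -> term).

Fixpoint vars (t : term) : seq V :=
  match t with
  | Var x => [:: x]
  | App f ts => flatten [seq vars (ts i) | i <- enum 'I_(arity f)]
  end.

(* Symbol and variable occurrences both count. *)
Fixpoint term_size (t : term) : nat :=
  match t with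
  | Var _ => 1
  | App f ts => (\sum_(i < arity f) term_size (ts i)).+1
  end.

Fixpoint subst (sigma : V -> term) (t : term) : term :=
  match t with
  | Var x => sigma x
  | App f ts => App (fun i => subst sigma (ts i))
  end.

Definition rules := set (term * term).

(* TRSs are finite, as usual in complexity analysis: an infinite one may have
   right-hand sides of unbounded interpretation. The signature is arbitrary. *)
Definition is_trs (R : rules) : Prop :=
  finite_set R /\
  forall l r, R (l, r) ->
    ~ (exists x, l = Var x) /\ {subset vars r <= vars l}.

Inductive rewrite (R : rules) : term -> term -> Prop :=
| rewrite_root l r sigma :
    R (l, r) -> rewrite R (subst sigma l) (subst sigma r)
| rewrite_arg f (i : 'I_(arity f)) (ts us : 'I_(arity f) -> term) :
    rewrite R (ts i) (us i) ->
    (forall j, j != i -> us j = ts j) ->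
    rewrite R (App ts) (App us).

Definition rel_rewrite (R S : rules) (t u : term) : Prop :=
  exists t' u', [/\ clos_refl_trans term (rewrite S) t t', rewrite R t' u'
                  & clos_refl_trans term (rewrite S) u' u].

End Terms.

Arguments Var {F V} x.
Arguments App {F V} f ts.
Arguments rules : clear implicits.

Section Complexity.
Variables (T : Type) (to : T -> T -> Prop).

Fixpoint steps (m : nat) (t u : T) : Prop :=
  if m is m'.+1 then exists2 v, to t v & steps m' v u else t = u.

Definition terminating (t : T) : Prop :=
  ~ exists s : nat -> T, s 0%N = t /\ forall i, to (s i) (s i.+1).

(* Derivation lengths and complexities live in N extended with infinity, here
   embedded in the extended reals. *)
Definition dl (K : realType) (t : T) : \bar K :=
  ereal_sup [set m%:R%:E | m in [set m : nat | exists u, steps m t u]].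

(* [ereal_sup set0] is [-oo]; the supremum of the empty set of extended
   naturals is 0, whence the [maxe 0]. *)
Definition cp (K : realType) (size : T -> nat) (n : nat) (L : set T) : \bar K :=
  maxe 0%E (ereal_sup [set dl K t | t in [set t | L t /\ (size t <= n)%N]]).

End Complexity.

Definition is_bigO (K : realType) (g h : nat -> \bar K) : Prop :=
  exists C : K, 0 < C /\
  exists N : nat, forall n, (N <= n)%N -> (g n <= C%:E * h n)%E.

Definition mx_le m n (A B : 'M[nat]_(m, n)) : Prop :=
  forall i j, (A i j <= B i j)%N.

Definition vec_ge d (u v : 'cV[nat]_d) : Prop := mx_le v u.

Definition vec_gt d (u v : 'cV[nat]_d.+1) : Prop :=
  (v ord0 ord0 < u ord0 ord0)%N /\ vec_ge u v.

(* [matrix_interp F d] has dimension [d.+1], so dimensions range over d >= 1. *)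
Record matrix_interp (F : signature) (d : nat) := MatrixInterp {
  mi_mx : forall f : F, 'I_(arity f) -> 'M[nat]_d.+1;
  mi_vec : F -> 'cV[nat]_d.+1;
  mi_mx_ge1 : forall (f : F) (i : 'I_(arity f)),
    (1 <= mi_mx i ord0 ord0)%N
}.

Section Interpretation.
Variables (F : signature) (V : eqType) (d : nat) (M : matrix_interp F d).
Implicit Types (alpha : V -> 'cV[nat]_d.+1) (s t : term F V).

Fixpoint eval alpha t : 'cV[nat]_d.+1 :=
  match t with
  | Var x => alpha x
  | App f ts => \sum_i mi_mx M i *m eval alpha (ts i) + mi_vec M f
  end.

Fixpoint coef_mx t (x : V) : 'M[nat]_d.+1 :=
  match t with
  | Var y => if y == x then 1%:M else 0
  | App f ts => \sum_i mi_mx M i *m coef_mx (ts i) x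
  end.

Fixpoint const_part t : 'cV[nat]_d.+1 :=
  match t with
  | Var _ => 0
  | App f ts => \sum_i mi_mx M i *m const_part (ts i) + mi_vec M f
  end.

(* Linear in alpha, with the variables of t listed without repetition; the
   coefficients are those of the decomposition [evalE] below. *)
Definition eval_ncp alpha t : 'cV[nat]_d.+1 :=
  \sum_(x <- undup (vars t)) coef_mx t x *m alpha x.

Lemma coef_mx_notin t x : x \notin vars t -> coef_mx t x = 0.
Proof.
elim: t => [y|f ts IH] /=; first by rewrite inE eq_sym => /negbTE->.
move=> xts; apply: big1 => i _; rewrite IH ?mulmx0//.
apply: contra xts => xi; apply/flattenP; exists (vars (ts i)) => //.
by apply: map_f; rewrite mem_enum.
Qed.

Lemma eval_linear alpha t (xs : seq V) : uniq xs -> {subset vars t <= xs} ->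
  eval alpha t = \sum_(x <- xs) coef_mx t x *m alpha x + const_part t.
Proof.
move=> xsU; elim: t => [y|f ts IH] /= sub.
  rewrite addr0 (bigD1_seq y) ?sub ?mem_head//= eqxx mul1mx big1 ?addr0// => x.
  by rewrite eq_sym => /negbTE->; rewrite mul0mx.
rewrite addrA; congr (_ + _).
rewrite (eq_bigr (fun i => \sum_(x <- xs) mi_mx M i *m (coef_mx (ts i) x *m alpha x)
    + mi_mx M i *m const_part (ts i))) => [|i _].
  rewrite big_split/=; congr (_ + _); rewrite exchange_big/=.
  apply: eq_bigr => x _; rewrite mulmx_suml.
  by apply: eq_bigr => i _; rewrite mulmxA.
rewrite IH ?mulmxDr ?mulmx_sumr// => x xi; apply: sub.
by apply/flattenP; exists (vars (ts i)) => //; apply: map_f; rewrite mem_enum.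
Qed.

Lemma evalE alpha t : eval alpha t = eval_ncp alpha t + const_part t.
Proof.
by apply: eval_linear; [exact: undup_uniq | move=> x; rewrite mem_undup].
Qed.

Definition interp_gt s t := forall alpha, vec_gt (eval alpha s) (eval alpha t).
Definition interp_ge s t := forall alpha, vec_ge (eval alpha s) (eval alpha t).
Definition interp_ge_ncp s t :=
  forall alpha, vec_ge (eval_ncp alpha s) (eval_ncp alpha t).

Definition compatible (R : rules F V) (sq : term F V -> term F V -> Prop) :=
  forall l r, R (l, r) -> sq l r.

End Interpretation.

Definition constant_growth (F : signature) d (M : matrix_interp F d) : Prop :=
  exists A : 'M[nat]_d.+1, forall Ms : seq 'M[nat]_d.+1,
    (forall B, B \in Ms -> exists (f : F) (i : 'I_(arity f)), B = mi_mx M i) ->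
    mx_le (\prod_(B <- Ms) B) A.

(* Main.v *)
(* Evaluate at the assignment 0 and follow the first component along a
   derivation. An R2-step decreases it by at least 1 and an S-step does not
   increase it. An R1-step applied below a context with coefficient P increases
   the evaluation by at most P times the constant part of the right-hand side,
   hence, by constant growth, by at most a constant D. Constant growth also
   bounds the initial value by c |t|. So a derivation with k1 R1-steps and k2
   R2-steps has k2 <= c |t| + D k1, while k1 is at most the derivation length of
   t for R1 / (R2 U S).

   The signature may be infinite, so the bound c |t| needs the vectors of the
   interpretation to be bounded. Only the symbols of the finitely many rules
   matter, so large vectors can be replaced by 0. *)
From Stdlib Require Import Relation_Operators.
From mathcomp Require Import all_boot all_order all_algebra.
From mathcomp Require Import all_classical all_reals ereal.
From mathcomp Require Import zify.
Require Import Defs.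

Set Implicit Arguments.
Unset Strict Implicit.
Unset Printing Implicit Defensive.

Import Order.TTheory GRing.Theory Num.Theory.
Local Open Scope classical_set_scope.
Local Open Scope ring_scope.

(** * Entrywise order on matrices over the naturals *)

Section NatMatrices.

Lemma mx_le_trans m n (B A C : 'M[nat]_(m, n)) :
  mx_le A B -> mx_le B C -> mx_le A C.
Proof. by move=> AB BC i j; exact: leq_trans (AB i j) (BC i j). Qed.

Lemma mx_le_addr m n (A B : 'M[nat]_(m, n)) : mx_le A (A + B).
Proof. by move=> i j; rewrite mxE; apply: leq_addr. Qed.

Lemma mx_leD m n (A B C D : 'M[nat]_(m, n)) :
  mx_le A B -> mx_le C D -> mx_le (A + C) (B + D).
Proof. by move=> AB CD i j; rewrite !mxE; apply: leq_add. Qed.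

Lemma mx_le_sum m n (I : finType) (A B : I -> 'M[nat]_(m, n)) :
  (forall i, mx_le (A i) (B i)) -> mx_le (\sum_i A i) (\sum_i B i).
Proof. by move=> AB i j; rewrite !summxE; apply: leq_sum => k _; apply: AB. Qed.

Lemma mx_leM m n p (A B : 'M[nat]_(m, n)) (C D : 'M[nat]_(n, p)) :
  mx_le A B -> mx_le C D -> mx_le (A *m C) (B *m D).
Proof.
by move=> AB CD i j; rewrite !mxE; apply: leq_sum => k _; apply: leq_mul.
Qed.

Definition cv_max d (v : 'cV[nat]_d) : nat := \max_i v i ord0.

Lemma cv_max_le d (v : 'cV[nat]_d) b :
  (cv_max v <= b)%N -> mx_le v (const_mx b).
Proof.
move=> vb i j; rewrite mxE (ord1 j); apply: leq_trans vb.
exact: (leq_bigmax (F := fun i => v i ord0)).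
Qed.

End NatMatrices.

Lemma finite_set_bounded (T : Type) (A : set T) (f : T -> nat) :
  finite_set A -> exists b, forall x, A x -> (f x <= b)%N.
Proof.
move=> /(finite_image f)/finite_seqP[s fAs]; exists (\max_(n <- s) n) => x Ax.
have : (f @` A) (f x) by exists x.
by rewrite fAs /= => fxs; exact: (leq_bigmax_seq (F := id)).
Qed.

(** * Effect of a rewrite step on the interpretation *)

Section InterpretationOfRewriting.
Variables (F : signature) (V : eqType) (d : nat) (M : matrix_interp F d).
Implicit Types (alpha : V -> 'cV[nat]_d.+1) (s t u : term F V).
Implicit Types (Ms : seq 'M[nat]_d.+1) (R : rules F V).

Definition coefs_of Ms :=
  forall B, B \in Ms -> exists (f : F) (i : 'I_(arity f)), B = mi_mx M i.

Lemma coefs_of_rcons Ms (f : F) (i : 'I_(arity f)) :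
  coefs_of Ms -> coefs_of (rcons Ms (mi_mx M i)).
Proof.
move=> MsM B; rewrite mem_rcons inE => /orP[/eqP->|/MsM//].
by exists f, i.
Qed.

Lemma eval_subst alpha (sigma : V -> term F V) t :
  eval M alpha (subst sigma t) = eval M (fun x => eval M alpha (sigma x)) t.
Proof.
elim: t => [//|f ts IH] /=; congr (_ + _).
by apply: eq_bigr => i _; rewrite IH.
Qed.

Lemma rewrite_ge R alpha s t : compatible R (interp_ge M) ->
  rewrite R s t -> vec_ge (eval M alpha s) (eval M alpha t).
Proof.
move=> geR; elim => [l r sigma /geR lr|f i ts us _ IH usts] /=.
  by rewrite !eval_subst; exact: lr.
apply: mx_leD => //; apply: mx_le_sum => j; apply: mx_leM => //.
by have [->//|/usts->] := eqVneq j i.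
Qed.

(** A strict decrease of the first component survives a context because the top-left entry of every
    coefficient matrix is at least 1; all other summands decrease weakly. *)
Lemma rewrite_gt R alpha s t : compatible R (interp_gt M) ->
  rewrite R s t -> vec_gt (eval M alpha s) (eval M alpha t).
Proof.
move=> gtR st; split; last first.
  by apply: (@rewrite_ge R) => // l r /gtR lr beta; case: (lr beta).
have geR : compatible R (interp_ge M).
  by move=> l r /gtR lr beta; case: (lr beta).
elim: st => [l r sigma /gtR lr|f i ts us st IH usts] /=.
  by rewrite !eval_subst; case: (lr (fun x => eval M alpha (sigma x))).
rewrite !mxE ltn_add2r !summxE.
rewrite (bigD1 i)//= [X in (_ < X)%N](bigD1 i)//=.
rewrite -addSn; apply: leq_add; last first.
  by apply: leq_sum => j /usts->.
rewrite !mxE big_ord_recl [X in (_ < X)%N]big_ord_recl -addSn.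
apply: leq_add; last first.
  by apply: leq_sum => j _; apply: leq_mul => //; exact: (rewrite_ge _ geR st).
by rewrite ltn_pmul2l//; exact: mi_mx_ge1.
Qed.

Lemma rewrite_star_ge R alpha s t : compatible R (interp_ge M) ->
  clos_refl_trans (term F V) (rewrite R) s t ->
  vec_ge (eval M alpha s) (eval M alpha t).
Proof.
move=> geR; elim=> [x y|x|x y z _ xy _ yz] //; first exact: rewrite_ge.
exact: mx_le_trans yz xy.
Qed.

Section ConstantGrowth.
Variables (A : 'M[nat]_d.+1) (b : nat).
Hypothesis growthA : forall Ms, coefs_of Ms -> mx_le (\prod_(B <- Ms) B) A.

(* Stated below an arbitrary context, of which only the product of the
   coefficients on the path to the hole matters. *)
Lemma rewrite_ncp_context R alpha s t Ms :
  compatible R (interp_ge_ncp M) ->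
  (forall l r, R (l, r) -> mx_le (const_part M r) (const_mx b)) ->
  rewrite R s t -> coefs_of Ms ->
  mx_le ((\prod_(B <- Ms) B) *m eval M alpha t)
    ((\prod_(B <- Ms) B) *m eval M alpha s + A *m const_mx b).
Proof.
move=> geR Rb st; elim: st Ms => [l r sigma Rlr|f i ts us _ IH usts] Ms MsM.
  rewrite !eval_subst !evalE mulmxDr; apply: mx_leD.
    (* The constant part of [l] is dropped; [geR] is used at the assignment obtained by evaluating
       [sigma]. *)
    by apply: mx_leM => //; apply: mx_le_trans (mx_le_addr _ _); exact: geR.
  by apply: mx_leM; [exact: growthA | exact: Rb Rlr].
rewrite /= !mulmxDr addrAC; apply: mx_leD => //.
rewrite !mulmx_sumr (bigD1 i)//= [X in mx_le _ (X + _)](bigD1 i)//= addrAC.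
apply: mx_leD; last by move=> k j; rewrite !summxE; apply: leq_sum => h /usts->.
(* The matrix of the [i]-th argument joins the path product, so the error term does not grow with
   the depth of the redex. *)
rewrite !mulmxA; move: (IH _ (coefs_of_rcons (i := i) MsM)).
by rewrite big_rcons.
Qed.

Lemma rewrite_ncp R alpha s t :
  compatible R (interp_ge_ncp M) ->
  (forall l r, R (l, r) -> mx_le (const_part M r) (const_mx b)) ->
  rewrite R s t ->
  mx_le (eval M alpha t) (eval M alpha s + A *m const_mx b).
Proof.
move=> geR Rb st; have := @rewrite_ncp_context R alpha s t [::] geR Rb st.
by rewrite big_nil !mul1mx; apply.
Qed.

(** Under the zero assignment, each symbol occurrence contributes its vector multiplied by the
    matrices on the path to it. That product is at most [A], so each occurrence costs at most
    [A *m const_mx b]. *)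
Lemma eval0_context Ms t :
  (forall f, mx_le (mi_vec M f) (const_mx b)) -> coefs_of Ms ->
  mx_le ((\prod_(B <- Ms) B) *m eval M (fun=> 0) t)
    ((A *m const_mx b) *+ term_size t).
Proof.
move=> vecb; elim: t Ms => [x|f ts IH] Ms MsM /=.
  by rewrite mulmx0 => i j; rewrite mxE.
rewrite mulmxDr mulmx_sumr mulrSr; apply: mx_leD.
  rewrite -sumrMnr; apply: mx_le_sum => i; rewrite mulmxA.
  by move: (IH i _ (coefs_of_rcons (i := i) MsM)); rewrite big_rcons.
by apply: mx_leM; [exact: growthA|].
Qed.

Lemma eval0_le t : (forall f, mx_le (mi_vec M f) (const_mx b)) ->
  mx_le (eval M (fun=> 0) t) ((A *m const_mx b) *+ term_size t).
Proof.
move=> vecb; have := @eval0_context [::] t vecb.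
by rewrite big_nil mul1mx; apply.
Qed.

End ConstantGrowth.
End InterpretationOfRewriting.

(** * Manipulating relative derivations *)

Section RelativeRewriting.
Variables (F : signature) (V : eqType).
Implicit Types (s t u : term F V) (R S : rules F V).

Lemma rewrite_setU R S t u :
  rewrite (R `|` S) t u -> rewrite R t u \/ rewrite S t u.
Proof.
elim=> [l r sigma [Rlr|Slr]|f i ts us _ [tu|tu] usts].
- by left; exact: rewrite_root.
- by right; exact: rewrite_root.
- by left; exact: rewrite_arg tu usts.
- by right; exact: rewrite_arg tu usts.
Qed.

Lemma rewrite_mono R S t u : R `<=` S -> rewrite R t u -> rewrite S t u.
Proof.
move=> RS; elim=> [l r sigma /RS|f i ts us _]; first exact: rewrite_root.
exact: rewrite_arg.
Qed.

Lemma rewrite_star_mono R S t u : R `<=` S ->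
  clos_refl_trans _ (rewrite R) t u -> clos_refl_trans _ (rewrite S) t u.
Proof.
move=> RS; elim=> [x y xy|x|x y z _ xy _ yz].
- exact/rt_step/(rewrite_mono RS).
- exact: rt_refl.
- exact: rt_trans xy yz.
Qed.

(** The leading [S]-steps are absorbed by the first relative step. For [k = 0] there is no such step
    and the derivation stays at [s], so the end term is not preserved. *)
Lemma steps_rel_rewrite_star R S k s t u :
  clos_refl_trans _ (rewrite S) s t -> steps (rel_rewrite R S) k t u ->
  exists v, steps (rel_rewrite R S) k s v.
Proof.
case: k => [_ _|k st]; first by exists s.
move=> [v [t' [v' [tt' t'v' v'v]]] vu]; exists u, v => //.
by exists t', v'; split=> //; exact: rt_trans st tt'.
Qed.

End RelativeRewriting.

(** * Bounding the length of a single derivation *)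

Section DerivationBound.
Variables (F : signature) (V : eqType) (R1 R2 S : rules F V).
Variables (d : nat) (M : matrix_interp F d).
Variables (A : 'M[nat]_d.+1) (b : nat).
Hypothesis growthA : forall Ms, coefs_of M Ms -> mx_le (\prod_(B <- Ms) B) A.
Hypothesis geR1 : compatible R1 (interp_ge_ncp M).
Hypothesis gtR2 : compatible R2 (interp_gt M).
Hypothesis geS : compatible S (interp_ge M).
Hypothesis R1b : forall l r, R1 (l, r) -> mx_le (const_part M r) (const_mx b).
Hypothesis vecb : forall f, mx_le (mi_vec M f) (const_mx b).

(** Serves twice: as the largest gain of one [R1]-step and as the largest contribution of one symbol
    to the initial value. *)
Let D := (A *m (const_mx b : 'cV[nat]_d.+1)) ord0 ord0.
Let value (t : term F V) := eval M (fun=> 0) t ord0 ord0.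

Lemma steps_count m t u : steps (rel_rewrite (R1 `|` R2) S) m t u ->
  exists k1 k2, [/\ m = (k1 + k2)%N, (value u + k2 <= value t + D * k1)%N
    & exists v, steps (rel_rewrite R1 (R2 `|` S)) k1 t v].
Proof.
have SU : S `<=` R2 `|` S by move=> ?; right.
elim: m t => [t /= ->|m IH t /= [v [t' [v' [tt' t'v' v'v]]] /IH]].
  by exists 0%N, 0%N; split => //; [rewrite muln0 | exists u].
move=> [k1 [k2 [-> le_vu [w vw]]]].
have le_tt' := rewrite_star_ge (fun=> 0) geS tt' ord0 ord0.
have le_v'v := rewrite_star_ge (fun=> 0) geS v'v ord0 ord0.
have [st|st] := rewrite_setU t'v'.
- exists k1.+1, k2; split=> //.
    have le_t'v' : (value v' <= value t' + D)%N.
      by have := rewrite_ncp growthA (fun=> 0) geR1 R1b st ord0 ord0; rewrite mxE.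
    by rewrite -!/(value _) in le_tt' le_v'v; rewrite mulnS; lia.
  exists w, v => //; exists t', v'.
  by split=> //; exact: rewrite_star_mono SU _.
- exists k1, k2.+1; split; first by rewrite addnS.
    have [lt_t'v' _] := rewrite_gt (fun=> 0) gtR2 st.
    by rewrite -!/(value _) in le_tt' le_v'v lt_t'v'; lia.
  (* The [R2]-step and its surrounding [S]-steps all are [R2]|[S]-steps, hence they only prefix the
     derivation of length [k1]. *)
  apply: (steps_rel_rewrite_star _ vw).
  apply: (rt_trans _ _ _ t'); first exact: rewrite_star_mono SU _.
  apply: (rt_trans _ _ _ v'); last exact: rewrite_star_mono SU _.
  by apply: rt_step; apply: rewrite_mono st => ?; left.
Qed.

(** The factor comes from [k1 + k2 <= k1 + D * k1 + D * term_size t]. *)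
Lemma steps_bound m t u : steps (rel_rewrite (R1 `|` R2) S) m t u ->
  exists2 k, (m <= D.+1 * (k + term_size t))%N
    & exists v, steps (rel_rewrite R1 (R2 `|` S)) k t v.
Proof.
move=> /steps_count[k1 [k2 [-> le_tu tv]]]; exists k1 => //.
have : (value t <= D * term_size t)%N.
  apply: leq_trans (eval0_le growthA t vecb ord0 ord0) _.
  by rewrite mulmxnE -/D; lia.
nia.
Qed.

End DerivationBound.

(** * Clipping the vectors of the interpretation *)

Section BoundedVectors.
Variables (F : signature) (V : eqType) (d : nat) (M : matrix_interp F d).
Variable b : nat.

Fixpoint max_vec (t : term F V) : nat :=
  match t with
  | Var _ => 0
  | App f ts => maxn (cv_max (mi_vec M f)) (\max_i max_vec (ts i))
  end.

Definition clip_vec : matrix_interp F d :=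
  MatrixInterp (fun f => if (cv_max (mi_vec M f) <= b)%N then mi_vec M f else 0)
    (mi_mx_ge1 M).

Lemma clip_vec_le f : mx_le (mi_vec clip_vec f) (const_mx b).
Proof.
rewrite /=; case: ifP => [/cv_max_le//|_] i j.
by rewrite !mxE.
Qed.

Lemma eval_clip_vec alpha (t : term F V) : (max_vec t <= b)%N ->
  eval clip_vec alpha t = eval M alpha t.
Proof.
elim: t => [//|f ts IH] /=; rewrite geq_max => /andP[-> /bigmax_leqP tsb].
by congr (_ + _); apply: eq_bigr => i _; rewrite IH ?tsb.
Qed.

Lemma const_part_clip_vec (t : term F V) : (max_vec t <= b)%N ->
  const_part clip_vec t = const_part M t.
Proof.
elim: t => [//|f ts IH] /=; rewrite geq_max => /andP[-> /bigmax_leqP tsb].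
by congr (_ + _); apply: eq_bigr => i _; rewrite IH ?tsb.
Qed.

End BoundedVectors.

(** Provides the clipping threshold: high enough to leave the evaluation of every rule unchanged and
    to bound the constant parts of right-hand sides. *)
Lemma rules_bounded (F : signature) (V : eqType) d (M : matrix_interp F d)
    (R : rules F V) : finite_set R ->
  exists b, forall l r, R (l, r) -> [/\ (max_vec M l <= b)%N,
    (max_vec M r <= b)%N & (cv_max (const_part M r) <= b)%N].
Proof.
pose f (p : term F V * term F V) :=
  (max_vec M p.1 + max_vec M p.2 + cv_max (const_part M p.2))%N.
move=> /(finite_set_bounded f)[b Rb]; exists b => l r /Rb; rewrite /f /=.
by split; lia.
Qed.

(** * From single derivations to complexity *)

Lemma cp_bigO (K : realType) (T : Type) (to1 to2 : T -> T -> Prop)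
    (size : T -> nat) (L : set T) (c : nat) :
  (forall m t u, steps to1 m t u ->
     exists2 k, (m <= c.+1 * (k + size t))%N & exists v, steps to2 k t v) ->
  is_bigO (fun n => cp to1 K size n L)
    (fun n => cp to2 K size n L + n%:R%:E)%E.
Proof.
move=> bound; exists c.+1%:R; split; first exact: ltr0Sn.
exists 0%N => n _; have cp_ge0 : (0 <= cp to2 K size n L)%E.
  by rewrite /cp le_max lexx.
(* The 0 in the [maxe] of [cp] is handled by nonnegativity of the right-hand side; the supremum
   remains. *)
rewrite {1}/cp ge_max mule_ge0 ?adde_ge0 ?lee_fin//=.
apply: ge_ereal_sup => _ [t [Lt tn] <-].
apply: ge_ereal_sup => _ [m [u /bound[k mk [v tv]]] <-].
apply: (@le_trans _ _ (c.+1%:R%:E * (k%:R%:E + n%:R%:E))%E).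
  rewrite -EFinD -EFinM lee_fin -natrD -natrM ler_nat.
  by apply: leq_trans mk _; rewrite leq_pmul2l// leq_add2l.
rewrite lee_wpmul2l ?lee_fin// leeD2r//.
rewrite /cp le_max; apply/orP; right.
apply: (@le_trans _ _ (dl to2 K t)); apply: ereal_sup_ubound.
  by exists k => //; exists v.
by exists t.
Qed.

Theorem theorem4p11 (K : realType) (F : signature) (V : eqType)
    (R1 R2 S : rules F V) (L : set (term F V))
    (d : nat) (M : matrix_interp F d)
    (trsR1 : is_trs R1) (trsR2 : is_trs R2) (trsS : is_trs S)
    (termL : forall t, L t -> terminating (rel_rewrite (R1 `|` R2) S) t)
    (growthM : constant_growth M)
    (geR1 : compatible R1 (interp_ge_ncp M))
    (gtR2 : compatible R2 (interp_gt M))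
    (geS : compatible S (interp_ge M)) :
  is_bigO
    (fun n => cp (rel_rewrite (R1 `|` R2) S) K (@term_size F V) n L)
    (fun n => cp (rel_rewrite R1 (R2 `|` S)) K (@term_size F V) n L
              + n%:R%:E)%E.
Proof.
have [A growthA] := growthM.
have [b Rb] : exists b, forall l r, (R1 `|` R2 `|` S) (l, r) ->
    [/\ (max_vec M l <= b)%N, (max_vec M r <= b)%N
      & (cv_max (const_part M r) <= b)%N].
  by apply: rules_bounded; rewrite !finite_setU; case: trsR1 trsR2 trsS
    => ? _ [? _] [? _].
apply: cp_bigO => m t u.
(* Clipping keeps the matrices, so constant growth and the condition on [R1] carry over by
   conversion. *)
apply: (@steps_bound F V R1 R2 S d (clip_vec M b) A b) => //.
- move=> l r R2lr alpha; have [|lb rb _] := Rb l r; first by left; right.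
  by rewrite !eval_clip_vec//; exact: gtR2.
- move=> l r Slr alpha; have [|lb rb _] := Rb l r; first by right.
  by rewrite !eval_clip_vec//; exact: geS.
- move=> l r R1lr; have [|_ rb cb] := Rb l r; first by left; left.
  by rewrite const_part_clip_vec//; exact: cv_max_le.
- exact: clip_vec_le.
Qed.
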